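(* Let $S,T\in\operatorname{End}(V\otimes V)$ be of six-vertex form (i.e. $d_1=d_2=0$), and assume that $a_1(S),a_2(S),b_1(S),b_2(S),c_1(S),c_2(S),a_1(T),a_2(T),b_1(T),b_2(T),c_1(T),c_2(T)$ are all nonzero. Then a necessary and sufficient condition for there to exist an $R\in\operatorname{End}(V\otimes V)$ of six-vertex form with $c_1(R)\neq 0$, $c_2(R)\neq 0$ and $\llbracket R,S,T\rrbracket=0$ is that $$\triangle_1(S)=\triangle_1(T)\quad\text{and}\quad \triangle_2(S)=\triangle_2(T).$$
   Context: Let $V$ be a two-dimensional complex vector space with basis $v_+,v_-$. Identify $\operatorname{End}(V\otimes V)$ with $4\times4$ matrices using the ordered basis $v_+\otimes v_+,\ v_+\otimes v_-,\ v_-\otimes v_+,\ v_-\otimes v_-$ (matrices act on column vectors). For a matrix of the form $$R=\begin{pmatrix}a_1&0&0&d_1\\0&b_1&c_1&0\\0&c_2&b_2&0\\d_2&0&0&a_2\end{pmatrix}$$ write $a_1(R)=a_1$, $a_2(R)=a_2$, $b_1(R)=b_1$, etc. $R$ is said to be of six-vertex form if it has this shape with $d_1=d_2=0$. For $\phi\in\operatorname{End}(V\otimes V)$ define $\phi_{12},\phi_{13},\phi_{23}\in\operatorname{End}(V\otimes V\otimes V)$ by requiring, for $\phi=\phi'\otimes\phi''$ with $\phi',\phi''\in\operatorname{End}(V)$, $\phi_{12}=\phi'\otimes\phi''\otimes1$, $\phi_{13}=\phi'\otimes1\otimes\phi''$, $\phi_{23}=1\otimes\phi'\otimes\phi''$,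 and extending linearly. The Yang–Baxter commutator is $\llbracket\phi,\psi,\chi\rrbracket=\phi_{12}\psi_{13}\chi_{23}-\chi_{23}\psi_{13}\phi_{12}$. For $R$ of six-vertex form with $a_1b_1a_2b_2\neq0$ set $$\triangle_1(R)=\frac{a_1a_2+b_1b_2-c_1c_2}{2a_1b_1},\qquad \triangle_2(R)=\frac{a_1a_2+b_1b_2-c_1c_2}{2a_2b_2},$$ where $a_1=a_1(R)$, etc. *)

(* Defs.v *)
From HB Require Import structures.
From mathcomp Require Import all_boot all_order all_algebra.
From mathcomp Require Export reals.
From mathcomp.real_closed Require Export complex mxtens.
From mathcomp Require Import ring.

Set Implicit Arguments.
Unset Strict Implicit.
Unset Printing Implicit Defensive.

Import GRing.Theory.
Local Open Scope ring_scope.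

Notation "A *t B" := (tensmx A B)
  (at level 40, left associativity, format "A  *t  B") : ring_scope.

(* End(V) is 'M_2, with v_+ and v_- the basis vectors 0 and 1 of V.  End(V (x) V)
   is 'M_(2 * 2): [mxtens_index (i, j)], of value 2 * i + j, is the position of
   v_i (x) v_j, so the ordered basis is v_++, v_+-, v_-+, v_--.  The entry A i j
   is the coefficient of the basis vector i in the image of the basis vector j. *)
Definition ipp : 'I_(2 * 2) := mxtens_index (0, 0).
Definition ipm : 'I_(2 * 2) := mxtens_index (0, 1).
Definition imp : 'I_(2 * 2) := mxtens_index (1, 0).
Definition imm : 'I_(2 * 2) := mxtens_index (1, 1).

Section Weights.
Variable K : fieldType.
Implicit Types R phi psi chi : 'M[K]_(2 * 2).

Definition vertex_mx (a1 a2 b1 b2 c1 c2 d1 d2 : K) : 'M[K]_(2 * 2) :=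
  \matrix_(i, j) (nth [::] [:: [:: a1; 0;  0;  d1];
                              [:: 0;  b1; c1; 0 ];
                              [:: 0;  c2; b2; 0 ];
                              [:: d2; 0;  0;  a2]] i)`_j.

Definition a1 R := R ipp ipp.
Definition a2 R := R imm imm.
Definition b1 R := R ipm ipm.
Definition b2 R := R imp imp.
Definition c1 R := R ipm imp.
Definition c2 R := R imp ipm.
Definition d1 R := R ipp imm.
Definition d2 R := R imm ipp.

Definition eight_vertex_form R : Prop :=
  R = vertex_mx (a1 R) (a2 R) (b1 R) (b2 R) (c1 R) (c2 R) (d1 R) (d2 R).

Definition six_vertex_form R : Prop :=
  [/\ eight_vertex_form R, d1 R = 0 & d2 R = 0].

Definition triangle1 R : K :=
  (a1 R * a2 R + b1 R * b2 R - c1 R * c2 R) / (2%:R * a1 R * b1 R).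
Definition triangle2 R : K :=
  (a1 R * a2 R + b1 R * b2 R - c1 R * c2 R) / (2%:R * a2 R * b2 R).

(* The linear extension to End(V (x) V) of a bilinear f, obtained by expanding
   phi on the basis E_ij (x) E_kl; see [tens_extE]. *)
Definition tens_ext (W : lmodType K) (f : 'M[K]_2 -> 'M[K]_2 -> W) phi : W :=
  \sum_i \sum_j \sum_k \sum_l
     phi (mxtens_index (i, k)) (mxtens_index (j, l))
       *: f (delta_mx i j) (delta_mx k l).

Definition leg12 phi : 'M[K]_(2 * 2 * 2) :=
  tens_ext (fun A B => A *t B *t 1%:M) phi.
Definition leg13 phi : 'M[K]_(2 * 2 * 2) :=
  tens_ext (fun A B => A *t 1%:M *t B) phi.
Definition leg23 phi : 'M[K]_(2 * 2 * 2) :=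
  tens_ext (fun A B => 1%:M *t A *t B) phi.

Definition yb_comm phi psi chi : 'M[K]_(2 * 2 * 2) :=
  leg12 phi *m leg13 psi *m leg23 chi - leg23 chi *m leg13 psi *m leg12 phi.

Lemma tens_ext_linear (W : lmodType K) (f : 'M[K]_2 -> 'M[K]_2 -> W) :
  linear (tens_ext f).
Proof.
move=> c phi psi; rewrite /tens_ext.
do 4!(rewrite scaler_sumr -big_split /=; apply: eq_bigr => ? _).
by rewrite !mxE scalerDl scalerA.
Qed.

Lemma tens_extE (W : lmodType K) (f : 'M[K]_2 -> 'M[K]_2 -> W) A B :
  (forall Y, linear (f^~ Y)) -> (forall X, linear (f X)) ->
  tens_ext f (A *t B) = f A B.
Proof.
move=> fl fr.
have sumE (g : 'M[K]_2 -> W) : linear g -> forall X,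
    g X = \sum_i \sum_j X i j *: g (delta_mx i j).
  move=> lg X.
  pose G := GRing.isLinear.Build K 'M[K]_2 W *:%R g lg.
  pose h : {linear 'M[K]_2 -> W} := HB.pack g G.
  rewrite [X in LHS]matrix_sum_delta -[g]/(h : _ -> _) linear_sum.
  apply: eq_bigr => i _; rewrite linear_sum; apply: eq_bigr => j _.
  by rewrite linearZ.
rewrite (sumE _ (fl B)) /tens_ext; apply: eq_bigr => i _; apply: eq_bigr => j _.
rewrite (sumE _ (fr _)) scaler_sumr; apply: eq_bigr => k _.
by rewrite scaler_sumr; apply: eq_bigr => l _; rewrite tensmxE scalerA.
Qed.

Lemma leg12_tens A B : leg12 (A *t B) = A *t B *t 1%:M.
Proof.
apply: (@tens_extE _ (fun A B => A *t B *t 1%:M)) => ? ? ? ?;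
  by apply/matrixP => ? ?; rewrite !mxE; ring.
Qed.

Lemma leg13_tens A B : leg13 (A *t B) = A *t 1%:M *t B.
Proof.
apply: (@tens_extE _ (fun A B => A *t 1%:M *t B)) => ? ? ? ?;
  by apply/matrixP => ? ?; rewrite !mxE; ring.
Qed.

Lemma leg23_tens A B : leg23 (A *t B) = 1%:M *t A *t B.
Proof.
apply: (@tens_extE _ (fun A B => 1%:M *t A *t B)) => ? ? ? ?;
  by apply/matrixP => ? ?; rewrite !mxE; ring.
Qed.

End Weights.

(* Main.v *)
Require Import Defs.
From mathcomp Require Import all_boot all_order all_algebra.
From mathcomp Require Import ring zify.

Set Implicit Arguments.
Unset Strict Implicit.
Unset Printing Implicit Defensive.

Import GRing.Theory Num.Theory.
Local Open Scope ring_scope.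

(** Six-vertex matrices preserve the charge of a basis vector, the number of its
    factors v_-, and so does the Yang-Baxter commutator.  Exchanging v_+ and v_-
    swaps the indices 1 and 2 of all weights.  Hence [yb_comm R S T = 0] amounts
    to seven cubic equations in charge 1, [star_triangle R S T], together with
    their images under the exchange.  These equations determine R from S and T
    up to a scalar: c1(R) c2(S) c1(T) = c2(R) c1(S) c2(T) fixes c1(R) : c2(R),
    those without a-weights of R give b1(R) and b2(R), and those with a term
    a_i(R) c_j(S) a_i(T) give a_i(R).  What remains of [star_triangle R S T] is
    the cross-multiplied form of [triangle1 S = triangle1 T], and the exchange
    turns it into that of [triangle2 S = triangle2 T]. *)

Lemma big_ord2 (V : Type) (idx : V) (op : Monoid.law idx) (F : 'I_2 -> V) :
  \big[op/idx]_i F i = op (F 0) (F 1).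
Proof.
by rewrite big_ord_recl big_ord1; congr (op _ (F _)); apply: val_inj.
Qed.

Lemma ord2_ind (P : 'I_2 -> Prop) : P 0 -> P 1 -> forall i, P i.
Proof.
move=> P0 P1 [[|[|//]] lt_i2].
  by rewrite (_ : Ordinal _ = 0) //; apply: val_inj.
by rewrite (_ : Ordinal _ = 1) //; apply: val_inj.
Qed.

Lemma sumr_mul_delta (A : pzSemiRingType) (I : finType) (F : I -> A) (i : I) :
  \sum_j F j * (j == i)%:R = F i.
Proof.
by under eq_bigr do rewrite mulr_natr mulrb; rewrite -big_mkcond big_pred1_eq.
Qed.

Lemma sum_mxtens (V : nmodType) m n (F : 'I_(m * n) -> V) :
  \sum_x F x = \sum_i \sum_j F (mxtens_index (i, j)).
Proof.
rewrite pair_bigA /= (reindex (@mxtens_index m n)) /=.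
  by apply: eq_bigr => -[].
by exists (@mxtens_unindex m n) => ? _; rewrite ?mxtens_indexK ?mxtens_unindexK.
Qed.

Lemma rev_ord_mxtens m n (i : 'I_m) (j : 'I_n) :
  rev_ord (mxtens_index (i, j)) = mxtens_index (rev_ord i, rev_ord j).
Proof.
apply: val_inj => /=; have [lt_im lt_jn] := (ltn_ord i, ltn_ord j).
rewrite mulnBl mulSn.
have : (i.+1 * n <= m * n)%N by rewrite leq_mul2r lt_im orbT.
by rewrite mulSn; lia.
Qed.

Local Notation idx2 i j := (mxtens_index (i, j)).
Local Notation idx3 i j k := (mxtens_index (mxtens_index (i, j), k)).

Lemma matrix_tens3P (A : Type) m n p m' n' p'
    (M N : 'M[A]_(m * n * p, m' * n' * p')) :
  (forall i j k i' j' k',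
     M (idx3 i j k) (idx3 i' j' k') = N (idx3 i j k) (idx3 i' j' k')) -> M = N.
Proof.
move=> eqMN; apply/matrixP => x y.
case: (mxtens_indexP x) => ij k; case: (mxtens_indexP ij) => i j.
by case: (mxtens_indexP y) => ij' k'; case: (mxtens_indexP ij').
Qed.

Section Legs.
Variable K : fieldType.
Implicit Types R S T phi : 'M[K]_(2 * 2).

Lemma tens_ext_entry m n (f : 'M[K]_2 -> 'M[K]_2 -> 'M[K]_(m, n))
    phi x y i j k l z :
  (forall A B, f A B x y = A i j * B k l * z) ->
  tens_ext f phi x y = phi (idx2 i k) (idx2 j l) * z.
Proof.
move=> fE; transitivity (\sum_i' (\sum_j' (\sum_k' (\sum_l'
    phi (idx2 i' k') (idx2 j' l') * z * (l' == l)%:R) * (k' == k)%:R)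
      * (j' == j)%:R) * (i' == i)%:R); last by rewrite !sumr_mul_delta.
rewrite /tens_ext.
do 4!(rewrite summxE ?mulr_suml; apply: eq_bigr => ? _; rewrite ?mulr_suml).
rewrite mxE fE !mxE ![_ == i]eq_sym ![_ == j]eq_sym.
by rewrite ![_ == k]eq_sym ![_ == l]eq_sym -!mulnb !natrM; ring.
Qed.

Lemma leg12E phi i j k i' j' k' :
  leg12 phi (idx3 i j k) (idx3 i' j' k') =
  phi (idx2 i j) (idx2 i' j') * (k == k')%:R.
Proof. by apply: tens_ext_entry => A B; rewrite !tensmxE mxE. Qed.

Lemma leg13E phi i j k i' j' k' :
  leg13 phi (idx3 i j k) (idx3 i' j' k') =
  phi (idx2 i k) (idx2 i' k') * (j == j')%:R.
Proof. by apply: tens_ext_entry => A B; rewrite !tensmxE mxE mulrAC. Qed.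

Lemma leg23E phi i j k i' j' k' :
  leg23 phi (idx3 i j k) (idx3 i' j' k') =
  phi (idx2 j k) (idx2 j' k') * (i == i')%:R.
Proof. by apply: tens_ext_entry => A B; rewrite !tensmxE mxE -mulrA mulrC. Qed.

Definition legE := (leg12E, leg13E, leg23E).

Lemma trmx_legs phi :
  ((leg12 phi)^T = leg12 phi^T) * ((leg13 phi)^T = leg13 phi^T) *
  ((leg23 phi)^T = leg23 phi^T).
Proof.
by do !split; apply: matrix_tens3P => *; rewrite mxE !legE mxE eq_sym.
Qed.

Lemma mul_leg12_leg13E R S i j k i' j' k' :
  (leg12 R *m leg13 S) (idx3 i j k) (idx3 i' j' k') =
  \sum_p R (idx2 i j) (idx2 p j') * S (idx2 p k) (idx2 i' k').
Proof.
rewrite mxE !sum_mxtens; apply: eq_bigr => p _.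
rewrite -(sumr_mul_delta (fun q => R _ (idx2 p q) * _)); apply: eq_bigr => q _.
rewrite -(sumr_mul_delta (fun r => _ * S (idx2 p r) _)) mulr_suml.
by apply: eq_bigr => r _; rewrite leg12E leg13E [k == r]eq_sym; ring.
Qed.

Lemma mul_legsE R S T i j k i' j' k' :
  (leg12 R *m leg13 S *m leg23 T) (idx3 i j k) (idx3 i' j' k') =
  \sum_p \sum_q \sum_r
    R (idx2 i j) (idx2 p q) * S (idx2 p k) (idx2 i' r)
      * T (idx2 q r) (idx2 j' k').
Proof.
rewrite mxE !sum_mxtens exchange_big [RHS]exchange_big /=.
apply: eq_bigr => q _; rewrite exchange_big [RHS]exchange_big /=.
apply: eq_bigr => r _; rewrite -mulr_suml.
rewrite -(sumr_mul_delta (fun i1 => (\sum_p _ * S _ (idx2 i1 r)) * _) i').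
by apply: eq_bigr => p _; rewrite mul_leg12_leg13E leg23E; ring.
Qed.

Lemma yb_commE R S T i j k i' j' k' :
  yb_comm R S T (idx3 i j k) (idx3 i' j' k') =
  \sum_p \sum_q \sum_r
     (R (idx2 i j) (idx2 p q) * S (idx2 p k) (idx2 i' r)
        * T (idx2 q r) (idx2 j' k')
      - T (idx2 j k) (idx2 q r) * S (idx2 i r) (idx2 p k')
        * R (idx2 p q) (idx2 i' j')).
Proof.
have -> : yb_comm R S T =
    leg12 R *m leg13 S *m leg23 T - (leg12 R^T *m leg13 S^T *m leg23 T^T)^T.
  by rewrite !trmx_mul !trmx_legs !trmxK mulmxA.
rewrite [LHS]mxE [X in _ + X]mxE [X in - X]mxE !mul_legsE.
rewrite -sumrB; apply: eq_bigr => p _; rewrite -sumrB; apply: eq_bigr => q _.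
by rewrite -sumrB; apply: eq_bigr => r _; rewrite !mxE; ring.
Qed.

End Legs.

(* Reversing the order of the basis of a tensor power of V exchanges v_+ and v_-
   in every factor. *)
Definition spin_flip (A : Type) m n (M : 'M[A]_(m, n)) : 'M[A]_(m, n) :=
  \matrix_(i, j) M (rev_ord i) (rev_ord j).

Lemma spin_flip_mul (A : pzSemiRingType) m n p
    (M : 'M[A]_(m, n)) (N : 'M[A]_(n, p)) :
  spin_flip (M *m N) = spin_flip M *m spin_flip N.
Proof.
apply/matrixP => i j; rewrite !mxE (reindex_inj rev_ord_inj).
by apply: eq_bigr => k _; rewrite !mxE.
Qed.

Section SpinFlip.
Variable K : fieldType.
Implicit Types R S T phi : 'M[K]_(2 * 2).

Lemma spin_flip_legs phi :
  (spin_flip (leg12 phi) = leg12 (spin_flip phi)) *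
  (spin_flip (leg13 phi) = leg13 (spin_flip phi)) *
  (spin_flip (leg23 phi) = leg23 (spin_flip phi)).
Proof.
by do !split; apply: matrix_tens3P => *;
  rewrite mxE !rev_ord_mxtens !legE mxE !rev_ord_mxtens (inj_eq rev_ord_inj).
Qed.

Lemma spin_flip_yb_comm R S T :
  spin_flip (yb_comm R S T) = yb_comm (spin_flip R) (spin_flip S) (spin_flip T).
Proof.
rewrite /yb_comm -!spin_flip_legs.
by rewrite -!spin_flip_mul; apply/matrixP => x y; rewrite !mxE.
Qed.

Lemma spin_flip_vertex_mx (x1 x2 y1 y2 z1 z2 w1 w2 : K) :
  spin_flip (vertex_mx x1 x2 y1 y2 z1 z2 w1 w2) =
  vertex_mx x2 x1 y2 y1 z2 z1 w2 w1.
Proof.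
apply/matrixP => i j; rewrite !mxE.
by case: i => -[|[|[|[]]]] //= ?; case: j => -[|[|[|[]]]].
Qed.

Lemma spin_flip_weights R :
  (a1 (spin_flip R) = a2 R) * (a2 (spin_flip R) = a1 R) *
  (b1 (spin_flip R) = b2 R) * (b2 (spin_flip R) = b1 R) *
  (c1 (spin_flip R) = c2 R) * (c2 (spin_flip R) = c1 R).
Proof.
have [rpp rpm] : rev_ord ipp = imm /\ rev_ord ipm = imp.
  by split; apply: val_inj.
have [rmp rmm] : rev_ord imp = ipm /\ rev_ord imm = ipp.
  by split; apply: val_inj.
by do !split; rewrite /a1 /a2 /b1 /b2 /c1 /c2 mxE ?rpp ?rpm ?rmp ?rmm.
Qed.

Lemma triangle1_spin_flip R : triangle1 (spin_flip R) = triangle2 R.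
Proof.
rewrite /triangle1 /triangle2 !spin_flip_weights.
by rewrite [a2 R * a1 R]mulrC [b2 R * b1 R]mulrC [c2 R * c1 R]mulrC.
Qed.

End SpinFlip.

Section SixVertex.
Variable K : fieldType.
Implicit Types R S T : 'M[K]_(2 * 2).

Lemma six_vertex_form_mx (x1 x2 y1 y2 z1 z2 : K) :
  six_vertex_form (vertex_mx x1 x2 y1 y2 z1 z2 0 0).
Proof.
by split; rewrite /eight_vertex_form /d1 /d2 /a1 /a2 /b1 /b2 /c1 /c2 !mxE.
Qed.

Lemma vertex_mx_weights (x1 x2 y1 y2 z1 z2 w1 w2 : K)
    (M := vertex_mx x1 x2 y1 y2 z1 z2 w1 w2) :
  (a1 M = x1) * (a2 M = x2) * (b1 M = y1) * (b2 M = y2) *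
  (c1 M = z1) * (c2 M = z2).
Proof. by rewrite /a1 /a2 /b1 /b2 /c1 /c2 !mxE. Qed.

Lemma six_vertex_form_spin_flip R :
  six_vertex_form R -> six_vertex_form (spin_flip R).
Proof.
case=> R8 d1R d2R; rewrite R8 d1R d2R spin_flip_vertex_mx.
exact: six_vertex_form_mx.
Qed.

Definition six_vertex_entry R (i j i' j' : 'I_2) : K :=
  match nat_of_ord i, nat_of_ord j, nat_of_ord i', nat_of_ord j' with
  | 0, 0, 0, 0 => a1 R | 1, 1, 1, 1 => a2 R
  | 0, 1, 0, 1 => b1 R | 1, 0, 1, 0 => b2 R
  | 0, 1, 1, 0 => c1 R | 1, 0, 0, 1 => c2 R
  | _, _, _, _ => 0%R
  end%N.

Lemma six_vertexE R i j i' j' : six_vertex_form R ->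
  R (idx2 i j) (idx2 i' j') = six_vertex_entry R i j i' j'.
Proof.
case=> R8 d1R d2R; rewrite {1}R8 d1R d2R mxE /six_vertex_entry.
by elim/ord2_ind: i; elim/ord2_ind: j; elim/ord2_ind: i'; elim/ord2_ind: j'.
Qed.

Lemma six_vertex_entry_charge R i j i' j' :
  six_vertex_entry R i j i' j' != 0 -> (i + j = i' + j')%N.
Proof.
by elim/ord2_ind: i; elim/ord2_ind: j; elim/ord2_ind: i'; elim/ord2_ind: j';
  rewrite //= eqxx.
Qed.

(* The Yang-Baxter equation on the span of the vectors of charge 1. *)
Definition star_triangle R S T : Prop :=
  [/\ a1 R * b1 S * c1 T = c2 R * c1 S * b1 T + b1 R * a1 S * c1 T /\
      a1 R * b1 S * c2 T = c1 R * c2 S * b1 T + b1 R * a1 S * c2 T,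
      a1 R * c1 S * a1 T = b2 R * c1 S * b1 T + c1 R * a1 S * c1 T /\
      a1 R * c2 S * a1 T = b2 R * c2 S * b1 T + c2 R * a1 S * c2 T,
      c1 R * b2 S * a1 T = b2 R * c1 S * c2 T + c1 R * a1 S * b2 T /\
      c2 R * b2 S * a1 T = b2 R * c2 S * c1 T + c2 R * a1 S * b2 T &
      c1 R * c2 S * c1 T = c2 R * c1 S * c2 T].

Section YangBaxter.
Variables R S T : 'M[K]_(2 * 2).
Hypotheses (hR : six_vertex_form R) (hS : six_vertex_form S).
Hypothesis hT : six_vertex_form T.

Lemma yb_comm_six_vertexE i j k i' j' k' :
  yb_comm R S T (idx3 i j k) (idx3 i' j' k') =
  \sum_p \sum_q \sum_r
     (six_vertex_entry R i j p q * six_vertex_entry S p k i' r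
        * six_vertex_entry T q r j' k'
      - six_vertex_entry T j k q r * six_vertex_entry S i r p k'
        * six_vertex_entry R p q i' j').
Proof.
by rewrite yb_commE; do 3!apply: eq_bigr => ? _; rewrite !six_vertexE.
Qed.

Lemma yb_comm_charge i j k i' j' k' :
  yb_comm R S T (idx3 i j k) (idx3 i' j' k') != 0 ->
  (i + j + k = i' + j' + k')%N.
Proof.
rewrite yb_comm_six_vertexE => nz; apply/eqP; apply: contraNT nz => charge.
apply/eqP; apply: big1 => p _; apply: big1 => q _; apply: big1 => r _.
rewrite -[RHS]subr0; congr (_ - _); apply/eqP; apply: contraNT charge;
  rewrite !mulf_eq0 !negb_or -andbA => /and3P[];
  do 3!move=> /six_vertex_entry_charge ?; lia.
Qed.

Ltac expand_entry := rewrite yb_comm_six_vertexE !big_ord2 /six_vertex_entry /=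
  ?(mul0r, mulr0, oppr0, addr0, add0r).

Lemma yb_comm_low_chargeP :
  star_triangle R S T <->
  forall i j k i' j' k' : 'I_2, (i + j + k <= 1)%N ->
    (i + j + k = i' + j' + k')%N ->
    yb_comm R S T (idx3 i j k) (idx3 i' j' k') = 0.
Proof.
split=> [[[abc1 abc2] [aca1 aca2] [cba1 cba2] ccc] i j k i' j' k'|yb0].
  elim/ord2_ind: i; elim/ord2_ind: j; elim/ord2_ind: k => //= _;
  elim/ord2_ind: i'; elim/ord2_ind: j'; elim/ord2_ind: k' => //= _;
  expand_entry; try by ring.
  - by ring: abc1.
  - by ring: aca1.
  - by ring: abc2.
  - by ring: ccc.
  - by ring: cba1.
  - by ring: aca2.
  - by ring: cba2.
split; [split | split | split | ]; apply/eqP; rewrite -subr_eq0; apply/eqP.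
- by rewrite -(yb0 0 0 1 0 1 0) //; expand_entry; ring.
- by rewrite -[RHS]oppr0 -(yb0 0 1 0 0 0 1) //; expand_entry; ring.
- by rewrite -(yb0 0 0 1 1 0 0) //; expand_entry; ring.
- by rewrite -[RHS]oppr0 -(yb0 1 0 0 0 0 1) //; expand_entry; ring.
- by rewrite -(yb0 0 1 0 1 0 0) //; expand_entry; ring.
- by rewrite -[RHS]oppr0 -(yb0 1 0 0 0 1 0) //; expand_entry; ring.
- by rewrite -(yb0 0 1 0 0 1 0) //; expand_entry; ring.
Qed.

End YangBaxter.

Lemma yb_comm_eq0 R S T :
  six_vertex_form R -> six_vertex_form S -> six_vertex_form T ->
  yb_comm R S T = 0 <->
  star_triangle R S T /\
  star_triangle (spin_flip R) (spin_flip S) (spin_flip T).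
Proof.
move=> hR hS hT.
have [hR' hS' hT'] := And3 (six_vertex_form_spin_flip hR)
  (six_vertex_form_spin_flip hS) (six_vertex_form_spin_flip hT).
rewrite !yb_comm_low_chargeP // -spin_flip_yb_comm.
split=> [->|[low high]]; first by split=> *; rewrite !mxE.
apply: matrix_tens3P => i j k i' j' k'; rewrite [RHS]mxE.
have [charge|] := eqVneq (i + j + k)%N (i' + j' + k')%N; last first.
  by move=> charge; apply/eqP; apply: contraNT charge => /yb_comm_charge->.
have [ijk_le1|ijk_gt1] := leqP (i + j + k) 1; first exact: low.
have [[lt_i lt_j] lt_k] := (ltn_ord i, ltn_ord j, ltn_ord k).
have [[lt_i' lt_j'] lt_k'] := (ltn_ord i', ltn_ord j', ltn_ord k').
rewrite -(high (rev_ord i) (rev_ord j) (rev_ord k)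
               (rev_ord i') (rev_ord j') (rev_ord k')) /=; [|lia|lia].
by rewrite [RHS]mxE !rev_ord_mxtens !rev_ordK.
Qed.

End SixVertex.

Section TriangleInvariants.
Variable K : fieldType.
Hypothesis two_neq0 : 2%:R != 0 :> K.
Implicit Types R S T : 'M[K]_(2 * 2).

Definition triangle_numer R : K := a1 R * a2 R + b1 R * b2 R - c1 R * c2 R.

Lemma eq_triangle1 S T :
  a1 S != 0 -> b1 S != 0 -> a1 T != 0 -> b1 T != 0 ->
  triangle1 S = triangle1 T <->
  triangle_numer S * (a1 T * b1 T) = triangle_numer T * (a1 S * b1 S).
Proof.
move=> a1S b1S a1T b1T.
suff eqb : (triangle1 S == triangle1 T) =
    (triangle_numer S * (a1 T * b1 T) == triangle_numer T * (a1 S * b1 S)).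
  by split=> /eqP; [rewrite eqb | rewrite -eqb] => /eqP.
rewrite /triangle1 eqr_div ?mulf_neq0 // -!mulrA ![_ * (2%:R * _)]mulrCA.
by rewrite (inj_eq (mulfI two_neq0)).
Qed.

Lemma yb_comm_triangle1 R S T :
  six_vertex_form R -> six_vertex_form S -> six_vertex_form T ->
  a1 S != 0 -> b1 S != 0 -> a1 T != 0 -> b1 T != 0 ->
  c1 R != 0 -> c1 T != 0 ->
  yb_comm R S T = 0 -> triangle1 S = triangle1 T.
Proof.
move=> hR hS hT a1S b1S a1T b1T c1R c1T /(yb_comm_eq0 hR hS hT)[].
case=> [[abc _] [aca _] [cba _] ccc] [_ _ [_ cba'] _].
rewrite !spin_flip_weights in cba'.
have b2R : b2 R * (c1 S * c2 T) = c1 R * (b2 S * a1 T - a1 S * b2 T).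
  by ring: cba.
have b1R : b1 R * (c1 S * c2 T) = c1 R * (b1 S * a2 T - a2 S * b1 T).
  by ring: cba'.
have : b2 R * (c1 S * c2 T) * (b1 T * b1 S * c1 T)
         + c1 R * (a1 S * b1 S * c1 T * c1 T * c2 T) =
       c2 R * c1 S * c2 T * (c1 S * a1 T * b1 T)
         + b1 R * (c1 S * c2 T) * (a1 S * c1 T * a1 T).
  by transitivity (a1 R * (b1 S * c1 T * c1 S * a1 T * c2 T));
    [ring: aca | ring: abc].
rewrite b2R b1R -ccc => /eqP; rewrite -subr_eq0 => /eqP a1R_elim.
apply/eq_triangle1 => //; rewrite /triangle_numer.
apply: (mulfI (mulf_neq0 c1R c1T)); apply: subr0_eq; rewrite -a1R_elim; ring.
Qed.

Lemma yb_comm_triangle2 R S T :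
  six_vertex_form R -> six_vertex_form S -> six_vertex_form T ->
  a2 S != 0 -> b2 S != 0 -> a2 T != 0 -> b2 T != 0 ->
  c2 R != 0 -> c2 T != 0 ->
  yb_comm R S T = 0 -> triangle2 S = triangle2 T.
Proof.
move=> hR hS hT a2S b2S a2T b2T c2R c2T yb0; rewrite -!triangle1_spin_flip.
apply: (@yb_comm_triangle1 (spin_flip R)); rewrite ?spin_flip_weights //;
  try exact: six_vertex_form_spin_flip.
by rewrite -spin_flip_yb_comm yb0; apply/matrixP => x y; rewrite !mxE.
Qed.

Definition yb_solution S T : 'M[K]_(2 * 2) :=
  vertex_mx
    (((b2 S * a1 T - a1 S * b2 T) * b1 T + a1 S * c1 T * c2 T) / a1 T)
    (((b1 S * a2 T - a2 S * b1 T) * b2 T + a2 S * c1 T * c2 T) / a2 T)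
    (b1 S * a2 T - a2 S * b1 T) (b2 S * a1 T - a1 S * b2 T)
    (c1 S * c2 T) (c2 S * c1 T) 0 0.

Lemma spin_flip_yb_solution S T :
  spin_flip (yb_solution S T) = yb_solution (spin_flip S) (spin_flip T).
Proof.
rewrite /yb_solution spin_flip_vertex_mx !spin_flip_weights.
by rewrite ![_ * c2 T * c1 T]mulrAC.
Qed.

Lemma star_triangle_yb_solution S T :
  a1 S != 0 -> b1 S != 0 -> a1 T != 0 -> b1 T != 0 ->
  triangle1 S = triangle1 T -> star_triangle (yb_solution S T) S T.
Proof.
move=> a1S b1S a1T b1T /(eq_triangle1 a1S b1S a1T b1T) eqST.
have a1R_b1S : a1 (yb_solution S T) * b1 S =
    c1 S * c2 S * b1 T + (b1 S * a2 T - a2 S * b1 T) * a1 S.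
  rewrite vertex_mx_weights; apply: (mulfI a1T).
  transitivity (triangle_numer S * (a1 T * b1 T)
    - triangle_numer T * (a1 S * b1 S)
    + a1 T * (c1 S * c2 S * b1 T + (b1 S * a2 T - a2 S * b1 T) * a1 S)).
    by rewrite /triangle_numer; field.
  by rewrite eqST subrr add0r.
split; [rewrite a1R_b1S | | | ]; rewrite !vertex_mx_weights;
  by [field | split; field].
Qed.

Lemma yb_comm_yb_solution S T :
  six_vertex_form S -> six_vertex_form T ->
  a1 S != 0 -> a2 S != 0 -> b1 S != 0 -> b2 S != 0 ->
  a1 T != 0 -> a2 T != 0 -> b1 T != 0 -> b2 T != 0 ->
  triangle1 S = triangle1 T -> triangle2 S = triangle2 T ->
  yb_comm (yb_solution S T) S T = 0.
Proof.
move=> hS hT a1S a2S b1S b2S a1T a2T b1T b2T eq1 eq2.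
apply/yb_comm_eq0 => //; first exact: six_vertex_form_mx.
rewrite spin_flip_yb_solution; split; apply: star_triangle_yb_solution;
  by rewrite ?spin_flip_weights ?triangle1_spin_flip.
Qed.

End TriangleInvariants.

Theorem theorem1 (F : realType) (S T : 'M[F[i]]_(2 * 2))
    (hS : six_vertex_form S) (hT : six_vertex_form T)
    (a1S : a1 S <> 0) (a2S : a2 S <> 0) (b1S : b1 S <> 0) (b2S : b2 S <> 0)
    (c1S : c1 S <> 0) (c2S : c2 S <> 0)
    (a1T : a1 T <> 0) (a2T : a2 T <> 0) (b1T : b1 T <> 0) (b2T : b2 T <> 0)
    (c1T : c1 T <> 0) (c2T : c2 T <> 0) :
  (exists R : 'M[F[i]]_(2 * 2),
     [/\ six_vertex_form R, c1 R <> 0, c2 R <> 0 & yb_comm R S T = 0])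
  <-> (triangle1 S = triangle1 T /\ triangle2 S = triangle2 T).
Proof.
have two_neq0 : 2%:R != 0 :> F[i] by rewrite pnatr_eq0.
move/eqP: (a1S) (a2S) (b1S) (b2S) (c1S) (c2S) => {}a1S /eqP {}a2S /eqP {}b1S.
move=> /eqP {}b2S /eqP {}c1S /eqP {}c2S.
move/eqP: (a1T) (a2T) (b1T) (b2T) (c1T) (c2T) => {}a1T /eqP {}a2T /eqP {}b1T.
move=> /eqP {}b2T /eqP {}c1T /eqP {}c2T.
split=> [[R [hR /eqP c1R /eqP c2R yb0]]|[eq1 eq2]].
  by split; [apply: yb_comm_triangle1 yb0 | apply: yb_comm_triangle2 yb0].
exists (yb_solution S T); split; rewrite ?vertex_mx_weights.
- exact: six_vertex_form_mx.
- by apply/eqP; rewrite mulf_neq0.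
- by apply/eqP; rewrite mulf_neq0.
- exact: yb_comm_yb_solution.
Qed.
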